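(* Let $G$ be a finite connected simple graph and let $k \geq 1$ be an integer. Then $$c_{H,k}(G) \leq \begin{cases} \alpha'(G), & \text{if } G \text{ has a perfect matching};\\ \alpha'(G) + 1, & \text{otherwise}.\end{cases}$$ Moreover, if $G$ has $n$ vertices, then $c_{H,k}(G) \leq \left\lceil \frac{n}{2} \right\rceil$.
   Context: The $k$-hyperopic game of cops and robber ($k \ge 1$ an integer) on a finite connected simple graph $G$ is played by a team of cops (controlled by one player) and one robber, all occupying vertices of $G$. First the cops choose their starting vertices (several cops may share a vertex), then the robber chooses his starting vertex. Then the players alternate turns, cops first: on the cops' turn each cop stays or moves to an adjacent vertex; on the robber's turn he stays or moves to an adjacent vertex. The robber always sees the positions of all cops. The robber is invisible to the cops whenever every cop satisfies $1 \le d(r,c) \le k$, where $r$ and $c$ are the current positions of the robber and that cop and $d$ is graph distance; otherwise (in particular whenever some cop is at distance greater than $k$ from him) his position is known to all cops. The robber is omniscient: he knows the complete strategy of the cops in advance, so he is never captured by chance, i.e. a winning cop strategy must guarantee capture against every possible play of the robber. The cops win if after finitely many rounds some cop occupies the same vertex as the robber; otherwise the robber wins. The $k$-hyperopic cop number $c_{H,k}(G)$ is the minimum number of cops that have a winning strategy on $G$. The matching number $\alpha'(G)$ is the maximum size of a matching in $G$. *)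

(* Defs.v *)
From mathcomp Require Import all_boot boolp.
Set Implicit Arguments.
Unset Strict Implicit.
Unset Printing Implicit Defensive.

(* A simple graph on the vertex set T is a symmetric irreflexive e : rel T. *)

Section Graph.
Variables (T : finType) (e : rel T).

Definition connected_graph : Prop := forall x y : T, connect e x y.

Definition edges : {set {set T}} :=
  [set A : {set T} | [exists x, exists y, e x y && (A == [set x; y])]].

Definition matching (M : {set {set T}}) : bool :=
  (M \subset edges) && trivIset M.

Definition matching_number : nat :=
  \max_(M : {set {set T}} | matching M) #|M|.

Definition has_perfect_matching : bool :=
  [exists M : {set {set T}}, matching M && (cover M == [set: T])].

Definition walk (n : nat) (x y : T) : bool :=
  [exists p : n.-tuple T, path e x p && (last x p == y)].

(* The least n such that walk n x y, when y is reachable from x: a shortest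
   walk has fewer than #|T| edges. Otherwise the value is #|T|. *)
Definition dist (x y : T) : nat := find (fun n => walk n x y) (iota 0 #|T|).

Lemma dist_min n x y : walk n x y -> dist x y <= n.
Proof.
move=> w; rewrite leqNgt; apply/negP => lt_n.
have lt_nT : n < #|T|.
  by apply: leq_trans lt_n _; rewrite -[leqRHS](size_iota 0) find_size.
by have := before_find 0 lt_n; rewrite nth_iota // add0n w.
Qed.

Lemma walk_dist x y : connect e x y -> walk (dist x y) x y.
Proof.
case/connectP => p0 /shortenP[p e_p Up _] y_p.
have w : walk (size p) x y.
  by apply/existsP; exists (in_tuple p); rewrite e_p y_p eqxx.
have lt_pT : size p < #|T| by have := max_card (mem (x :: p)); rewrite (card_uniqP Up).
have has_w : has (fun n => walk n x y) (iota 0 #|T|).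
  by apply/hasP; exists (size p); rewrite ?mem_iota.
have := nth_find 0 has_w; rewrite nth_iota //.
by rewrite -[ltnRHS](size_iota 0) -has_find.
Qed.

Definition step (x y : T) : bool := (x == y) || e x y.

End Graph.

Section Game.
Variables (T : finType) (e : rel T) (k m : nat).

Definition cops := {ffun 'I_m -> T}.

Definition invisible (c : cops) (r : T) : bool :=
  [forall i, 1 <= dist e r (c i) <= k].

Definition captured (c : cops) (r : T) : bool := [exists i, c i == r].

(* What the cops know of a position: their own vertices, and the vertex of the
   robber unless he is invisible. *)
Definition view : Type := (cops * option T)%type.

Definition observe (c : cops) (r : T) : view :=
  (c, if invisible c r then None else Some r).

(* The next configuration depends on all earlier views, most recent first, and
   on the view at the start of the cops' turn. *)
Record strategy := Strategy {
  initial : cops;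
  next : seq view -> view -> cops;
  next_legal : forall (past : seq view) (v : view) (i : 'I_m),
    step e (v.1 i) (next past v i)
}.

Definition robber_legal (r : nat -> T) : Prop :=
  forall n, step e (r n) (r n.+1).

(* The play of s against the robber who starts at r 0 and moves to r n.+1 at the
   end of round n: the past views and the cops' configuration at the start of
   round n. Both the position before the cops' move and the one between the two
   moves are observed in each round. *)
Fixpoint play (s : strategy) (r : nat -> T) (n : nat) : seq view * cops :=
  match n with
  | 0 => ([::], initial s)
  | n'.+1 =>
      let: (past, c) := play s r n' in
      let v := observe c (r n') in
      let c' := next s past v in
      (observe c' (r n') :: v :: past, c')
  end.

Definition cops_at (s : strategy) (r : nat -> T) (n : nat) : cops :=
  (play s r n).2.

(* The robber can be caught by his own move or at the start (first disjunct) or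
   by a move of the cops (second disjunct). As r is quantified after s, the
   robber may use full knowledge of s. *)
Definition winning (s : strategy) : Prop :=
  forall r, robber_legal r ->
  exists n, captured (cops_at s r n) (r n) || captured (cops_at s r n.+1) (r n).

Definition cops_win : Prop := exists s, winning s.

End Game.

Section CopNumber.
Variables (T : finType) (e : rel T) (k : nat).

Lemma cops_win_card : cops_win e k #|T|.
Proof.
pose stay (past : seq (view T #|T|)) (v : view T #|T|) := v.1.
have legal past (v : view T #|T|) (i : 'I_#|T|) :
    step e (v.1 i) (stay past v i) by rewrite /step eqxx.
exists (Strategy (m := #|T|) [ffun i => enum_val i] legal) => r _; exists 0.
apply/orP; left; apply/existsP; exists (enum_rank (r 0)).
by rewrite ffunE enum_rankK.
Qed.

Lemma ex_cops_win : exists m, `[< cops_win e k m >].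
Proof. by exists #|T|; apply/asboolP; exact: cops_win_card. Qed.

Definition hyperopic_cop_number : nat := ex_minn ex_cops_win.

End CopNumber.

(* Main.v *)
Require Import Defs.
From mathcomp Require Import all_boot boolp.

(** The bound is reached by cops who search blindly: they follow a schedule fixed
    in advance, one walk per cop, whatever they see of the robber
    ([cop_number_le_schedule]).

    Given a matching [M], assign one cop to each edge of [M] and let him go back
    and forth between its two ends. In each round he occupies one end before the
    cops' move and the other end after it, so a robber who stands on a covered
    vertex is caught in that very round ([matching_patrol]). If [M] is perfect,
    this happens in the first round.

    Otherwise let [M] be a maximum matching. The uncovered vertices then form an
    independent set ([uncovered_independent]), so a robber who avoids the covered
    vertices can never leave his starting vertex. One more cop, who walks through
    all vertices of the connected graph ([exhaustive_walk]), finds him there.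

    The bound by half of the number of vertices follows by counting: a matching
    covers twice as many vertices as it has edges ([card_cover_matching]). *)

Set Implicit Arguments.
Unset Strict Implicit.
Unset Printing Implicit Defensive.

Lemma edgesP (T : finType) (e : rel T) (A : {set T}) :
  reflect (exists x y, e x y /\ A = [set x; y]) (A \in edges e).
Proof.
rewrite inE; apply: (iffP existsP) => [[x /existsP[y /andP[exy /eqP->]]]|].
  by exists x, y.
by move=> [x [y [exy ->]]]; exists x; apply/existsP; exists y; rewrite exy eqxx.
Qed.

Lemma card_cover_matching (T : finType) (e : rel T) (M : {set {set T}}) :
  irreflexive e -> matching e M -> #|cover M| = #|M|.*2.
Proof.
move=> e_irr /andP[/subsetP sME /eqP <-].
rewrite (eq_bigr (fun=> 2)) => [|A /sME /edgesP[x [y [exy ->]]]].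
  by rewrite sum_nat_const muln2.
by rewrite cards2; case: eqP exy => // ->; rewrite e_irr.
Qed.

Lemma leq_matching_number (T : finType) (e : rel T) (M : {set {set T}}) :
  matching e M -> #|M| <= matching_number e.
Proof. by move=> mM; rewrite /matching_number (bigmax_sup M). Qed.

Lemma maximum_matching (T : finType) (e : rel T) :
  exists2 M : {set {set T}}, matching e M & #|M| = matching_number e.
Proof.
have m0 : matching e (set0 : {set {set T}}).
  by rewrite /matching sub0set; apply/trivIsetP => A B; rewrite inE.
have [|M mM eqM] :=
    @eq_bigmax_cond _ (matching e) (fun M : {set {set T}} => #|M|).
  by apply/card_gt0P; exists set0.
by exists M.
Qed.

(** An edge between uncovered vertices would enlarge the matching. *)
Lemma uncovered_independent (T : finType) (e : rel T) (M : {set {set T}}) x y :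
    matching e M -> #|M| = matching_number e ->
  x \notin cover M -> y \notin cover M -> ~~ e x y.
Proof.
move=> mM maxM xM yM; apply/negP => exy.
have [/subsetP sME tM] := andP mM.
have disjM : {in M, forall B : {set T}, [disjoint [set x; y] & B]}.
  move=> B BM; rewrite disjoint_subset; apply/subsetP => z.
  rewrite !inE => z_xy; apply/negP => zB.
  have: z \in cover M by apply/bigcupP; exists B.
  by apply/negP; case/orP: z_xy => /eqP->.
have set0M : set0 \notin M.
  apply/negP => /sME /edgesP[a [b [_ /setP/(_ a)]]].
  by rewrite !inE eqxx.
have [tM' newM] := trivIsetU1 disjM tM set0M.
have mM' : matching e ([set x; y] |: M).
  rewrite /matching tM' andbT; apply/subsetP => B; rewrite inE.
  by case/orP=> [/set1P->|/sME//]; apply/edgesP; exists x, y.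
by have := leq_matching_number mM'; rewrite cardsU1 newM -maxM ltnn.
Qed.

Definition lazy_walk (T : finType) (e : rel T) (w : nat -> T) : Prop :=
  forall n, step e (w n) (w n.+1).

Definition caught_in_round (T : eqType) (w r : nat -> T) (n : nat) : bool :=
  (w n == r n) || (w n.+1 == r n).

(** A fixed schedule is a special strategy: each round adds two views to the
    past, so the cops can read off the number of the current round. *)
Lemma cop_number_le_schedule (T : finType) (e : rel T) (k : nat) (I : finType)
    (w : I -> nat -> T) :
    (forall i, lazy_walk e (w i)) ->
    (forall r, lazy_walk e r -> exists n i, caught_in_round (w i) r n) ->
  hyperopic_cop_number e k <= #|I|.
Proof.
move=> w_walk w_catch.
pose at_round n : cops T #|I| := [ffun i => w (enum_val i) n].
(* A strategy must be legal after every sequence of views, also after those that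
   no play produces: there the cops stay where they are. *)
pose move_cops (past : seq (view T #|I|)) (v : view T #|I|) : cops T #|I| :=
  [ffun i => let y := at_round (size past)./2.+1 i in
             if step e (v.1 i) y then y else v.1 i].
have legal past (v : view T #|I|) i : step e (v.1 i) (move_cops past v i).
  by rewrite ffunE /=; case: ifP => // _; rewrite /step eqxx.
pose s := Strategy (at_round 0) legal.
have play_s (r : nat -> T) n :
    size (play k s r n).1 = n.*2 /\ (play k s r n).2 = at_round n.
  elim: n => //= n; case: (play k s r n) => past c /= [szE ->].
  split; first by rewrite szE doubleS.
  by apply/ffunP => i; rewrite !ffunE szE doubleK /= w_walk.
rewrite /hyperopic_cop_number; case: (ex_minnP (ex_cops_win e k)) => m _ m_min.
apply: m_min; apply/asboolP.
exists s => r /w_catch[n [i caught]]; exists n.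
have at_i j : at_round j (enum_rank i) = w i j by rewrite ffunE enum_rankK.
rewrite /cops_at (play_s r n).2 (play_s r n.+1).2.
by case/orP: caught => eq_r; apply/orP; [left | right];
  apply/existsP; exists (enum_rank i); rewrite at_i.
Qed.

(** The cop of an edge stands at one end in even rounds and at the other in odd
    rounds. His position before and after his move in a round are thus the two
    ends, and the robber, who moves only afterwards, is caught at either. *)
Lemma matching_patrol (T : finType) (e : rel T) (M : {set {set T}}) :
    symmetric e -> matching e M ->
  exists2 w : {A | A \in M} -> nat -> T,
    (forall i, lazy_walk e (w i)) &
    forall r n, r n \in cover M -> exists i, caught_in_round (w i) r n.
Proof.
move=> e_sym /andP[/subsetP sME _].
have ends (i : {A | A \in M}) : exists f : bool -> T,
    e (f false) (f true) /\ val i = [set f false; f true].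
  have /edgesP[x [y xyP]] := sME _ (valP i).
  by exists (fun b => if b then y else x).
have [f fP] := fin_all_exists ends.
exists (fun i n => f i (odd n)) => [i n|r n /bigcupP[A AM rA]].
  by rewrite /step /=; case: (odd n) => /=; rewrite 1?[e _ (f i false)]e_sym
    (fP i).1 orbT.
pose i : {A | A \in M} := exist _ A AM.
exists i; move: rA; have [_ /= ->] := fP i; rewrite /caught_in_round !inE.
by rewrite ![r n == _]eq_sym /=; case: (odd n) => /= /orP[]->; rewrite ?orbT.
Qed.

Lemma exhaustive_walk (T : finType) (e : rel T) (x0 : T) :
    connected_graph e ->
  exists2 w : nat -> T, lazy_walk e w & forall x, exists n, w n = x.
Proof.
move=> e_conn.
have tour (s : seq T) x : exists2 p, path e x p & {subset s <= x :: p}.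
  elim: s x => [|y s IHs] x; first by exists [::].
  have /connectP[p e_p y_p] := e_conn x y; have [q e_q sq] := IHs y.
  have y_xp : y \in x :: p by rewrite y_p mem_last.
  exists (p ++ q) => [|z]; first by rewrite cat_path e_p -y_p.
  rewrite inE -cat_cons mem_cat => /orP[/eqP->|/sq]; first by rewrite y_xp.
  by rewrite inE => /orP[/eqP->|->]; rewrite ?y_xp ?orbT.
have [p e_p sp] := tour (enum T) x0.
(* Beyond the end of the tour the walk stays at its last vertex. *)
exists (nth (last x0 p) (x0 :: p)) => [n|x]; last first.
  have x_p : x \in x0 :: p by rewrite sp ?mem_enum.
  by exists (index x (x0 :: p)); rewrite nth_index.
have [lt_n|le_n] := ltnP n (size p).
  by rewrite /step (pathP (last x0 p) e_p) // orbT.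
rewrite /step [nth _ _ n.+1]nth_default //.
move: le_n; rewrite leq_eqVlt => /predU1P[<-|lt_n].
  by rewrite nth_last /= eqxx.
by rewrite nth_default ?eqxx.
Qed.

Lemma cop_number_le_perfect (T : finType) (e : rel T) (k : nat)
    (M : {set {set T}}) :
    symmetric e -> matching e M -> cover M = [set: T] ->
  hyperopic_cop_number e k <= #|M|.
Proof.
move=> e_sym mM covM; have [w w_walk w_catch] := matching_patrol e_sym mM.
have <- : #|{: {A | A \in M}}| = #|M| by rewrite card_sig; apply: eq_card.
apply: (cop_number_le_schedule k w_walk) => r _.
by exists 0; apply: w_catch; rewrite covM inE.
Qed.

Lemma cop_number_le_maximum (T : finType) (e : rel T) (k : nat)
    (M : {set {set T}}) :
    symmetric e -> connected_graph e ->
    matching e M -> #|M| = matching_number e -> cover M != [set: T] ->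
  hyperopic_cop_number e k <= #|M|.+1.
Proof.
move=> e_sym e_conn mM maxM covM.
have [x0 _] : exists x0, x0 \notin cover M.
  by apply/existsP; apply: contraR covM => /existsPn inM;
    apply/eqP/setP => x; rewrite inE; apply/negPn/inM.
have [w w_walk w_catch] := matching_patrol e_sym mM.
have [t t_walk t_onto] := exhaustive_walk x0 e_conn.
have <- : #|{: {A | A \in M}}| = #|M| by rewrite card_sig; apply: eq_card.
rewrite -card_option.
apply: (@cop_number_le_schedule _ _ k _ (oapp w t)) => [|r r_walk].
  by case.
have [[n /w_catch[i caught]]|avoids] := pselect (exists n, r n \in cover M).
  by exists n, (Some i).
have uncovered n : r n \notin cover M by apply/negP => rM; apply: avoids; exists n.
have still n : r n = r 0.
  elim: n => // n <-; have := r_walk n; rewrite /step.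
  by rewrite (negPf (uncovered_independent mM maxM _ _)) // orbF => /eqP.
have [n t_n] := t_onto (r 0).
by exists n, None; rewrite /caught_in_round /= t_n still eqxx.
Qed.

Theorem corollary3p2 (T : finType) (e : rel T)
    (e_sym : symmetric e) (e_irr : irreflexive e) (e_conn : connected_graph e)
    (k : nat) (k_ge1 : 1 <= k) :
  hyperopic_cop_number e k <=
    (if has_perfect_matching e then matching_number e
     else matching_number e + 1)
  /\
  hyperopic_cop_number e k <= uphalf #|T|.
Proof.
have [/existsP[M /andP[mM /eqP covM]]|not_perfect] := ifPn.
  have le_M := cop_number_le_perfect k e_sym mM covM.
  split; first exact: leq_trans le_M (leq_matching_number mM).
  apply: leq_trans le_M _.
  by rewrite geq_uphalf_double -(card_cover_matching e_irr mM) covM cardsT.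
have [M mM maxM] := maximum_matching e.
have covM : cover M != [set: T].
  by apply: contra not_perfect => covM; apply/existsP; exists M; rewrite mM.
have le_M := cop_number_le_maximum k e_sym e_conn mM maxM covM.
rewrite addn1 -maxM; split=> //; apply: leq_trans le_M _.
rewrite geq_uphalf_double doubleS !ltnS -(card_cover_matching e_irr mM).
by rewrite -cardsT proper_card // properT.
Qed.
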